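(* Let $t\in\mathbb R\setminus\{0\}$ and let $\alpha\in\mathbb H_t$ be such that $B_\alpha$ is defined (i.e. $\|\alpha\|_{op}<1$, $\Gamma_\alpha$ is invertible, and $L_\alpha$ has a $[*]$-self-adjoint square root $K_\alpha\in\mathbb H_t$). A function $f\in\mathbf H_{2,[*]}^t$ vanishes at $\alpha$ (i.e. $f(\alpha)=0$) if and only if $f=B_\alpha\star g$ where $g\in\mathbf H_{2,[*]}^t$ satisfies $[f,f]_{[*]}=[g,g]_{[*]}$.
   Context: For $t\in\mathbb R\setminus\{0\}$, $\mathbb H_t$ is the real algebra (matrix addition and multiplication) of matrices $q_t=\begin{pmatrix}a&tb\\ \overline b&\overline a\end{pmatrix}$, $a,b\in\mathbb C$, with unit $1=I_2$; $q_t^{[*]}=\begin{pmatrix}a&t\overline b\\ b&\overline a\end{pmatrix}$, $\alpha^{[*]n}=(\alpha^{[*]})^n$; $\|q_t\|_E=\sqrt{|a|^2+|t||b|^2}$ and $\|q_t\|_{op}$ is the operator norm of the matrix on $\mathbb C^2$. $\mathbf H_2^t$ is the real vector space of power series $f(q_t)=\sum_{n=0}^\infty q_t^n\alpha_n$, $\alpha_n\in\mathbb H_t$, with $\sum_n\|\alpha_n\|_E^2<\infty$; such a series converges for $\|q_t\|_{op}<1$ and $f(\alpha)=\sum_n\alpha^n\alpha_n$. $\mathbf H_{2,[*]}^t$ is $\mathbf H_2^t$ endowed with the real symmetric form $[f,g]_{[*]}=\sum_{n=0}^\infty{\rm Tr}\,(g_n^{[*]}f_n)$ for $f=\sum q_t^nf_n$,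 $g=\sum q_t^ng_n$. The $\star$-product of power series is $\left(\sum q_t^n\alpha_n\right)\star\left(\sum q_t^n\beta_n\right)=\sum_n q_t^n\sum_{k=0}^n\alpha_{n-k}\beta_k$, and $S^{-\star}$ is the inverse of $S$ for $\star$. For $\alpha\in\mathbb H_t$ with $\|\alpha\|_{op}<1$ let $\Gamma_\alpha=\sum_{n=0}^\infty\alpha^n\alpha^{[*]n}$; when $\Gamma_\alpha$ is invertible let $L_\alpha=\Gamma_\alpha-\Gamma_\alpha\alpha^{[*]}\Gamma_\alpha^{-1}\alpha\Gamma_\alpha$, and let $K_\alpha=L_\alpha^{1/2}\in\mathbb H_t$ denote an element with $K_\alpha=K_\alpha^{[*]}$ and $K_\alpha^2=L_\alpha$ (these conditions hold for all $\alpha$ of small enough norm). Then $$B_\alpha(q_t)=(q_t-\alpha)\star(1-q_t\Gamma_\alpha\alpha^{[*]}\Gamma_\alpha^{-1})^{-\star}K_\alpha .$$ *)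

(* Defs.v *)
From HB Require Import structures.
From mathcomp Require Import all_boot all_order all_algebra.
From mathcomp Require Import all_classical all_reals all_analysis.
From mathcomp Require Import complex.

Set Implicit Arguments.
Unset Strict Implicit.
Unset Printing Implicit Defensive.

Import Order.TTheory GRing.Theory Num.Theory.
Import numFieldNormedType.Exports.

Local Open Scope classical_set_scope.
Local Open Scope ring_scope.

(* The complex field R[i], seen as a numClosedFieldType so that it carries the
   topology induced by its modulus; matrices over it then carry the entrywise
   (product) topology. *)
Definition Cplx (R : realType) : numClosedFieldType := R[i].

Definition modulus (R : realType) (z : Cplx R) : R := complex.Re `|z|.

Definition hquat (R : realType) (t : R) (a b : Cplx R) : 'M[Cplx R]_2 :=
  \matrix_(i, j)
    if i == 0 then (if j == 0 then a else (t%:C)%C * b)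
    else (if j == 0 then b^* else a^*).

Definition Ht (R : realType) (t : R) : set 'M[Cplx R]_2 :=
  [set q | exists a b : Cplx R, q = hquat t a b].

(* hcoefa (hquat t a b) = a and hcoefb (hquat t a b) = b. *)
Definition hcoefa (R : realType) (q : 'M[Cplx R]_2) : Cplx R := q 0 0.
Definition hcoefb (R : realType) (q : 'M[Cplx R]_2) : Cplx R := (q 1 0)^*.

Definition hstar (R : realType) (t : R) (q : 'M[Cplx R]_2) : 'M[Cplx R]_2 :=
  hquat t (hcoefa q) (hcoefb q)^*.

Definition hnormE (R : realType) (t : R) (q : 'M[Cplx R]_2) : R :=
  Num.sqrt (modulus (hcoefa q) ^+ 2 + `|t| * modulus (hcoefb q) ^+ 2).

Definition l2norm (R : realType) (n : nat) (v : 'cV[Cplx R]_n) : R :=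
  Num.sqrt (\sum_i modulus (v i 0) ^+ 2).

Definition opnorm (R : realType) (q : 'M[Cplx R]_2) : R :=
  sup [set l2norm (q *m v) | v in [set v : 'cV[Cplx R]_2 | l2norm v <= 1]].

(* A power series \sum_n q_t^n f_n is identified with its coefficients. *)
Definition hseries (R : realType) := nat -> 'M[Cplx R]_2.

(* hmono n c is the series q_t^n c. *)
Definition hmono (R : realType) (n : nat) (c : 'M[Cplx R]_2) : hseries R :=
  fun k => if k == n then c else 0.

Definition star_mul (R : realType) (f g : hseries R) : hseries R :=
  fun n => \sum_(k < n.+1) f (n - k)%N * g k.

(* A two-sided inverse for star_mul is unique when it exists, and it exists as
   soon as the constant coefficient is a unit. *)
Definition star_inv (R : realType) (f : hseries R) : hseries R :=
  get [set g | star_mul f g = hmono 0%N 1 /\ star_mul g f = hmono 0%N 1].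

Definition hseries_eval (R : realType) (f : hseries R) (q : 'M[Cplx R]_2) :
    'M[Cplx R]_2 :=
  limn (series (fun n => q ^+ n * f n)).

Definition hardy2 (R : realType) (t : R) : set (hseries R) :=
  [set f | (forall n, Ht t (f n)) /\
           cvgn (series (fun n => hnormE t (f n) ^+ 2))].

(* Traces of elements of H_t are real: \tr (hquat t a b) = a + a^*; Re only
   moves the value from R[i] to R. *)
Definition hform (R : realType) (t : R) (f g : hseries R) : R :=
  limn (series (fun n => complex.Re (\tr (hstar t (g n) * f n)))).

Definition Gamma_op (R : realType) (t : R) (alpha : 'M[Cplx R]_2) : 'M[Cplx R]_2 :=
  limn (series (fun n => alpha ^+ n * hstar t alpha ^+ n)).

Definition Lambda_op (R : realType) (t : R) (alpha : 'M[Cplx R]_2) : 'M[Cplx R]_2 :=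
  let G := Gamma_op t alpha in
  G - G * hstar t alpha * G^-1 * alpha * G.

Definition Blaschke (R : realType) (t : R) (alpha K : 'M[Cplx R]_2) :
    hseries R :=
  let G := Gamma_op t alpha in
  star_mul
    (star_mul (hmono 1%N 1 \- hmono 0%N alpha)
     (star_inv (hmono 0%N 1 \- hmono 1%N (G * hstar t alpha * G^-1))))
    (hmono 0%N K).

(* Main.v *)
(** Write [a] for [alpha], [a*] for its involution, [G] for [Gamma_a] and
    [b = G a* G^-1], so that [G = 1 + a G a*].  With [P = G^-1 + a* a] one finds
    [L_a P = 1] and [P b = a*]; in particular [K] is invertible with inverse
    [K P].

    Since [(1 - q b)] has [star]-inverse [sum q^n b^n], the equation
    [f = B_a * g] means that some sequence [u] satisfies
    [f_n = u_(n-1) - a u_n] and [K g_n = u_n - b u_(n-1)], with [u_(-1) = 0].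
    The first relation makes the partial sums of [f(a)] telescope to
    [- a^N u_(N-1)], which tends to [0] because [u] is bounded.  Conversely, if
    [f(a) = 0] then the tails [u_(n-1) = sum_k a^k f_(n+k)] satisfy the first
    relation, are square summable, and the second one defines [g].  Finally
    [g_n* g_n - f_n* f_n = u_n* G^-1 u_n - u_(n-1)* G^-1 u_(n-1)], so that the
    two forms agree because [u_n] tends to [0]. *)

Require Import Defs.
From mathcomp Require Import all_boot all_order all_algebra.
From mathcomp Require Import all_classical all_reals all_analysis.
From mathcomp Require Import complex zify ring lra.

Set Implicit Arguments.
Unset Strict Implicit.
Unset Printing Implicit Defensive.

Import Order.TTheory GRing.Theory Num.Theory.
Import numFieldNormedType.Exports.

Local Open Scope classical_set_scope.
Local Open Scope ring_scope.

(** * The modulus of the complex field as a real number *)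

Section Modulus.
Variable R : realType.
Implicit Types (z w : Cplx R) (x : R).

Lemma modulusE z : (modulus z)%:C%C = `|z|.
Proof. by apply: RRe_real; exact: normr_real. Qed.

Lemma modulus_ge0 z : 0 <= modulus z.
Proof. by rewrite -ler0c modulusE. Qed.

Lemma modulus0 : modulus (0 : Cplx R) = 0.
Proof. by rewrite /modulus normr0. Qed.

Lemma modulus1 : modulus (1 : Cplx R) = 1.
Proof. by rewrite /modulus normr1. Qed.

Lemma modulusM z w : modulus (z * w) = modulus z * modulus w.
Proof. by apply: complexI; rewrite rmorphM /= !modulusE normrM. Qed.

Lemma modulusN z : modulus (- z) = modulus z.
Proof. by rewrite /modulus normrN. Qed.

Lemma ler_modulusD z w : modulus (z + w) <= modulus z + modulus w.
Proof. by rewrite -lecR rmorphD /= !modulusE ler_normD. Qed.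

Lemma modulus_eq0 z : modulus z = 0 -> z = 0.
Proof. by move=> z0; apply/eqP; rewrite -normr_eq0 -modulusE z0. Qed.

Lemma modulusJ z : modulus z^* = modulus z.
Proof. by rewrite /modulus norm_conjC. Qed.

Lemma modulusC x : modulus (x%:C%C : Cplx R) = `|x|.
Proof. by rewrite /modulus normc_def /= expr0n addr0 sqrtr_sqr. Qed.

Lemma modulus_sqr z : modulus z ^+ 2 = complex.Re z ^+ 2 + complex.Im z ^+ 2.
Proof. by rewrite /modulus normc_def /= sqr_sqrtr // addr_ge0 ?sqr_ge0. Qed.

Lemma ler_Re_modulus z : `|complex.Re z| <= modulus z.
Proof. by rewrite -lecR modulusE normc_ge_Re. Qed.

Lemma ler_Im_modulus z : `|complex.Im z| <= modulus z.
Proof.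
rewrite -ler_sqr ?nnegrE ?modulus_ge0 // modulus_sqr real_normK ?num_real //.
by rewrite lerDr sqr_ge0.
Qed.

Lemma ler_modulus_ReIm z : modulus z <= `|complex.Re z| + `|complex.Im z|.
Proof.
rewrite -ler_sqr ?nnegrE ?modulus_ge0 ?addr_ge0 // modulus_sqr sqrrD.
rewrite !real_normK ?num_real //.
have : 0 <= `|complex.Re z| * `|complex.Im z| by rewrite mulr_ge0.
lra.
Qed.

Lemma Re_sum (I : Type) (r : seq I) (P : pred I) (F : I -> Cplx R) :
  complex.Re (\sum_(i <- r | P i) F i) = \sum_(i <- r | P i) complex.Re (F i).
Proof. by elim/big_rec2 : _ => // i y1 y2 _ <-; case: (F i) y2 => ? ? []. Qed.

Lemma Im_sum (I : Type) (r : seq I) (P : pred I) (F : I -> Cplx R) :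
  complex.Im (\sum_(i <- r | P i) F i) = \sum_(i <- r | P i) complex.Im (F i).
Proof. by elim/big_rec2 : _ => // i y1 y2 _ <-; case: (F i) y2 => ? ? []. Qed.

End Modulus.

(** * The sum of the entry moduli *)

Section EntryNorm.
Variable R : realType.
Implicit Types (n : nat).

(** A real-valued submultiplicative norm on all matrices, independent of [t]; every estimate below
    is made in it, and [hnormE] and [opnorm] are compared with it once. *)
Definition mxnorm1 n (q : 'M[Cplx R]_n) : R :=
  \sum_i \sum_j modulus (q i j).

Variable n : nat.
Implicit Types p q : 'M[Cplx R]_n.

Lemma mxnorm1_ge0 q : 0 <= mxnorm1 q.
Proof. by do 2!apply: sumr_ge0 => ? _; exact: modulus_ge0. Qed.

Lemma ler_entry_mxnorm1 q i j : modulus (q i j) <= mxnorm1 q.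
Proof.
rewrite /mxnorm1 (bigD1 i) //= (bigD1 j) //= -addrA lerDl addr_ge0 //.
  by apply: sumr_ge0 => ? _; exact: modulus_ge0.
by do 2!apply: sumr_ge0 => ? _; exact: modulus_ge0.
Qed.

Lemma mxnorm10 : mxnorm1 (0 : 'M[Cplx R]_n) = 0.
Proof.
rewrite /mxnorm1 big1 // => i _; rewrite big1 // => j _.
by rewrite mxE modulus0.
Qed.

Lemma mxnorm1N q : mxnorm1 (- q) = mxnorm1 q.
Proof. by apply: eq_bigr => i _; apply: eq_bigr => j _; rewrite mxE modulusN. Qed.

Lemma ler_mxnorm1D p q : mxnorm1 (p + q) <= mxnorm1 p + mxnorm1 q.
Proof.
rewrite /mxnorm1 -big_split; apply: ler_sum => i _ /=.
by rewrite -big_split; apply: ler_sum => j _ /=; rewrite mxE ler_modulusD.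
Qed.

Lemma ler_mxnorm1B p q : mxnorm1 (p - q) <= mxnorm1 p + mxnorm1 q.
Proof. by rewrite (le_trans (ler_mxnorm1D _ _)) // mxnorm1N. Qed.

Lemma ler_mxnorm1_sum (I : Type) (r : seq I) (P : pred I)
    (F : I -> 'M[Cplx R]_n) :
  mxnorm1 (\sum_(i <- r | P i) F i) <= \sum_(i <- r | P i) mxnorm1 (F i).
Proof.
elim/big_rec2 : _ => [|i y1 y2 _ IH]; first by rewrite mxnorm10.
by rewrite (le_trans (ler_mxnorm1D _ _)) // lerD2l.
Qed.

Lemma ler_mxnorm1M p q : mxnorm1 (p * q) <= mxnorm1 p * mxnorm1 q.
Proof.
have b0 k : 0 <= \sum_j modulus (q k j).
  by apply: sumr_ge0 => ? _; exact: modulus_ge0.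
rewrite [mxnorm1 p]/mxnorm1 mulr_suml; apply: ler_sum => i _.
rewrite mulr_suml.
apply: (@le_trans _ _ (\sum_j \sum_k modulus (p i k) * modulus (q k j))).
  apply: ler_sum => j _; rewrite -mulmxE mxE.
  elim/big_rec2 : _ => [|k y1 y2 _ IH]; first by rewrite modulus0.
  by rewrite (le_trans (ler_modulusD _ _)) // modulusM lerD2l.
rewrite exchange_big /=; apply: ler_sum => k _.
(* After the exchange of sums, the row sum of [q] at [k] is enlarged to the sum over all rows. *)
rewrite -mulr_sumr ler_wpM2l ?modulus_ge0 // /mxnorm1 [leRHS](bigD1 k) //= lerDl.
by apply: sumr_ge0.
Qed.

End EntryNorm.

(** * Convergence of complex matrices in the entry norm *)

Lemma cvg_sum0 (R : realFieldType) (I : Type) (r : seq I) (f : I -> R^nat) :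
  (forall i, f i @ \oo --> 0) ->
  (fun k => \sum_(i <- r) f i k) @ \oo --> (0 : R).
Proof.
move=> f0; elim: r => [|i r IH].
  have -> : (fun k => \sum_(i <- [::]) f i k) = fun=> 0.
    by apply/funext => k; rewrite big_nil.
  exact: cvg_cst.
have -> : (fun k => \sum_(i <- i :: r) f i k) =
    f i \+ (fun k => \sum_(i <- r) f i k).
  by apply/funext => k; rewrite big_cons.
by rewrite -[X in _ --> X](addr0 0); exact: cvgD (f0 i) IH.
Qed.

Section EntryNormTopology.
Variables (R : realType) (n : nat).
Implicit Types (q L : 'M[Cplx R]_n) (u h : nat -> 'M[Cplx R]_n).

(** Entrywise convergence has balls whose radii lie in the complex field; this trades it for a null
    sequence of reals. *)
Lemma cvg_mxnorm1P u L :
  u @ \oo --> L <-> (fun k => mxnorm1 (L - u k)) @ \oo --> (0 : R).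
Proof.
split.
- move=> /cvg_ballP uL; apply/cvgrPdist_lt => e e0.
  (* The [n * n] entries, each at most [d], add up to strictly less than [e]; the successor keeps
     this true for [n = 0]. *)
  pose d := e / (n * n).+1%:R.
  have d0 : 0 < d by rewrite divr_gt0 // ltr0n.
  have dC0 : (0 : Cplx R) < (d%:C)%C by rewrite ltcR.
  have := uL _ dC0; apply: filterS => k [_ Lk].
  rewrite sub0r normrN ger0_norm ?mxnorm1_ge0 //.
  apply: (@le_lt_trans _ _ (\sum_(i < n) \sum_(j < n) d)).
    apply: ler_sum => i _; apply: ler_sum => j _; rewrite !mxE.
    have := Lk i j; rewrite -ball_normE /= -modulusE ltcR; exact: ltW.
  rewrite !sumr_const card_ord -mulrnA -mulr_natr /d -mulrA mulrC.
  rewrite -ltr_pdivlMr // divff ?gt_eqF //.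
  by rewrite mulrC ltr_pdivrMr ?ltr0n // mul1r ltr_nat.
- move=> /cvgrPdist_lt uL; apply/cvg_ballP => e e0.
  (* A positive element of the complex field is real, so the radius equals its real part. *)
  have eE : e = ((complex.Re e)%:C)%C.
    by apply/esym/RRe_real/ger0_real/ltW.
  have e1 : 0 < complex.Re e by move: e0; rewrite {1}eE ltcR.
  have := uL _ e1; apply: filterS => k.
  rewrite sub0r normrN ger0_norm ?mxnorm1_ge0 // => Lk.
  split=> // i j; rewrite -ball_normE /= -modulusE [ltRHS]eE ltcR.
  apply: le_lt_trans Lk.
  by rewrite (le_trans _ (ler_entry_mxnorm1 _ i j)) // !mxE.
Qed.

Lemma mx_cvg_lim u L : u @ \oo --> L -> limn u = L.
Proof. by move/cvg_lim; apply; exact: norm_hausdorff. Qed.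

Lemma mx_cvg_unique u L L' : u @ \oo --> L -> u @ \oo --> L' -> L = L'.
Proof. by move=> /mx_cvg_lim <- /mx_cvg_lim <-. Qed.

Lemma cvg_mx_le u L (v : R^nat) :
  (forall k, mxnorm1 (L - u k) <= v k) -> v @ \oo --> 0 -> u @ \oo --> L.
Proof.
move=> uv v0; apply/cvg_mxnorm1P.
apply: (squeeze_cvgr (f := fun=> 0) _ (cvg_cst _) v0).
by apply: nearW => k /=; rewrite mxnorm1_ge0 uv.
Qed.

Lemma cvg_mx_bounded_map (phi : 'M[Cplx R]_n -> 'M[Cplx R]_n) C u L :
    {morph phi : p q / p - q} ->
    (forall q, mxnorm1 (phi q) <= C * mxnorm1 q) ->
  u @ \oo --> L -> (fun k => phi (u k)) @ \oo --> phi L.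
Proof.
move=> phiB phiC /cvg_mxnorm1P uL.
apply: (@cvg_mx_le _ _ (fun k => C * mxnorm1 (L - u k))) => [k|].
  by rewrite -phiB.
by rewrite -[X in _ --> X](mulr0 C); apply: cvgM => //; exact: cvg_cst.
Qed.

Lemma cvg_mx_mxnorm1_le u L B :
  u @ \oo --> L -> (forall k, mxnorm1 (u k) <= B) -> mxnorm1 L <= B.
Proof.
move=> /cvg_mxnorm1P uL uB.
have uBL : (fun k => mxnorm1 (L - u k) + B) @ \oo --> 0 + B.
  by apply: cvgD uL _; exact: cvg_cst.
rewrite -[leRHS]add0r; apply: (ler_cvg_to (cvg_cst _) uBL).
apply: nearW => k /=; rewrite -[X in mxnorm1 X <= _](subrK (u k)).
by rewrite (le_trans (ler_mxnorm1D _ _)) // lerD2l.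
Qed.

Lemma series_le_geometric_cvg (v : R^nat) C r : 0 <= r < 1 ->
  (forall k, `|v k| <= C * r ^+ k) -> cvgn (series v).
Proof.
move=> /andP[r0 r1] vC; apply: normed_cvg.
apply: (@series_le_cvg _ _ (geometric C r)) => [k|k|k|].
- exact: normr_ge0.
- exact: le_trans (vC k).
- exact: vC.
- by apply: is_cvg_geometric_series; rewrite ger0_norm.
Qed.

(** Completeness of the reals is applied to the real and imaginary part of each entry, all dominated
    by the same geometric series. *)
Lemma mx_series_cvg h C r : 0 <= r < 1 ->
    (forall k, mxnorm1 (h k) <= C * r ^+ k) ->
  exists L, series h @ \oo --> L.
Proof.
move=> r01 hC.
have cRe i j : cvgn (series (fun k => complex.Re (h k i j))).
  apply: (series_le_geometric_cvg r01) => k; apply: le_trans (hC k).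
  by apply: le_trans (ler_Re_modulus _) _; exact: ler_entry_mxnorm1.
have cIm i j : cvgn (series (fun k => complex.Im (h k i j))).
  apply: (series_le_geometric_cvg r01) => k; apply: le_trans (hC k).
  by apply: le_trans (ler_Im_modulus _) _; exact: ler_entry_mxnorm1.
pose L : 'M[Cplx R]_n := \matrix_(i, j)
  (Complex (limn (series (fun k => complex.Re (h k i j))))
           (limn (series (fun k => complex.Im (h k i j)))) : Cplx R).
exists L.
apply: (@cvg_mx_le _ _ (fun k => \sum_i \sum_j
  (`|complex.Re (L i j) - series (fun k => complex.Re (h k i j)) k| +
   `|complex.Im (L i j) - series (fun k => complex.Im (h k i j)) k|))).
  move=> k; apply: ler_sum => i _; apply: ler_sum => j _.
  apply: le_trans (ler_modulus_ReIm _) _.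
  rewrite !mxE !seriesEnat /= summxE -Re_sum -Im_sum.
  by case: (\sum_(_ <= _ < _) _).
apply: cvg_sum0 => i; apply: cvg_sum0 => j.
have sub0 (v : R^nat) l : v @ \oo --> l -> `|l - v k| @[k --> \oo] --> (0 : R).
  move=> vl; rewrite -(@normr0 _ R) -(subrr l).
  by apply: cvg_norm; apply: cvgB => //; exact: cvg_cst.
rewrite -[X in _ --> X](addr0 0).
apply: cvgD; apply: sub0; rewrite mxE /=; [exact: cRe|exact: cIm].
Qed.

End EntryNormTopology.

(** * Powers of a contraction *)

Section OperatorNorm.
Variable R : realType.

Lemma l2norm_ge0 n (v : 'cV[Cplx R]_n) : 0 <= l2norm v.
Proof. exact: sqrtr_ge0. Qed.

Lemma ler_modulus_l2norm n (v : 'cV[Cplx R]_n) i : modulus (v i 0) <= l2norm v.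
Proof.
rewrite -[leLHS]ger0_norm ?modulus_ge0 // -sqrtr_sqr ler_wsqrtr //.
by rewrite (bigD1 i) //= lerDl sumr_ge0 // => j _; rewrite sqr_ge0.
Qed.

Lemma l2normZ n (c : R) (v : 'cV[Cplx R]_n) : 0 <= c ->
  l2norm ((c%:C)%C *: v) = c * l2norm v.
Proof.
move=> c0; rewrite -[in RHS](ger0_norm c0) -sqrtr_sqr -sqrtrM ?sqr_ge0 //.
rewrite mulr_sumr; congr Num.sqrt; apply: eq_bigr => i _.
by rewrite mxE modulusM modulusC ger0_norm // exprMn.
Qed.

Lemma l2norm_le n (v : 'cV[Cplx R]_n) B : 0 <= B ->
  (forall i, modulus (v i 0) <= B) -> l2norm v <= B *+ n.
Proof.
move=> B0 vB; rewrite -[leRHS]ger0_norm ?mulrn_wge0 // -sqrtr_sqr ler_wsqrtr //.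
apply: (@le_trans _ _ (\sum_(i < n) B ^+ 2)).
  by apply: ler_sum => i _; rewrite ler_sqr ?nnegrE ?modulus_ge0.
rewrite sumr_const card_ord -[in leRHS]mulr_natr exprMn -[leLHS]mulr_natr.
rewrite ler_wpM2l ?sqr_ge0 // -natrX ler_nat.
by case: n {v vB} => // n; rewrite expnS expn1 leq_pmulr.
Qed.

Lemma l2norm_eq0 n (v : 'cV[Cplx R]_n) : l2norm v = 0 -> v = 0.
Proof.
move=> v0; apply/matrixP => i j; rewrite ord1 mxE; apply: modulus_eq0.
by apply/eqP; rewrite eq_le modulus_ge0 andbT -v0 ler_modulus_l2norm.
Qed.

Lemma l2norm0 n : l2norm (0 : 'cV[Cplx R]_n) = 0.
Proof.
by rewrite /l2norm big1 ?sqrtr0 // => i _; rewrite mxE modulus0 expr0n.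
Qed.

Variable q : 'M[Cplx R]_2.

(** Only finiteness matters here: it makes the [sup] in [opnorm] a genuine upper bound. *)
Lemma opnorm_has_ubound :
  has_ubound [set l2norm (q *m v) | v in [set v : 'cV[Cplx R]_2 | l2norm v <= 1]].
Proof.
exists (mxnorm1 q *+ 2) => _ [v /= v1 <-].
apply: l2norm_le => [|i]; first exact: mxnorm1_ge0.
apply: (@le_trans _ _ (\sum_j modulus (q i j))).
  rewrite mxE; elim/big_rec2 : _ => [|j x y _ IH]; first by rewrite modulus0.
  rewrite (le_trans (ler_modulusD _ _)) // modulusM lerD //.
  rewrite -[leRHS]mulr1 ler_wpM2l ?modulus_ge0 //.
  exact: le_trans (ler_modulus_l2norm _ _) v1.
rewrite /mxnorm1 [leRHS](bigD1 i) //= lerDl; apply: sumr_ge0 => k _.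
by apply: sumr_ge0 => j _; exact: modulus_ge0.
Qed.

Lemma opnorm_ge0 : 0 <= opnorm q.
Proof.
apply: (ub_le_sup opnorm_has_ubound); exists 0; rewrite /= ?l2norm0 //.
by rewrite mulmx0 l2norm0.
Qed.

Lemma ler_l2norm_opnorm v : l2norm (q *m v) <= opnorm q * l2norm v.
Proof.
have [/l2norm_eq0 ->|v0] := eqVneq (l2norm v) 0.
  by rewrite mulmx0 l2norm0 mulr0.
have vp : 0 < l2norm v by rewrite lt_def v0 l2norm_ge0.
rewrite -ler_pdivrMr // mulrC -l2normZ ?invr_ge0 ?l2norm_ge0 //.
apply: (ub_le_sup opnorm_has_ubound).
exists ((((l2norm v)^-1)%:C)%C *: v); last by rewrite scalemxAr.
by rewrite /= l2normZ ?invr_ge0 ?l2norm_ge0 // mulVf.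
Qed.

(** Each of the four entries of [q ^+ k] is a coordinate of the image of a unit basis vector, hence
    at most [opnorm q ^+ k]. Through this bound [opnorm alpha < 1] yields geometric decay. *)
Lemma ler_mxnorm1_exp_opnorm k : mxnorm1 (q ^+ k) <= opnorm q ^+ k *+ 4.
Proof.
have qk v : l2norm (q ^+ k *m v) <= opnorm q ^+ k * l2norm v.
  elim: k => [|k IH]; first by rewrite !expr0 mul1mx mul1r.
  rewrite !exprS -mulrA -mulmxE -mulmxA (le_trans (ler_l2norm_opnorm _)) //.
  by rewrite ler_wpM2l ?opnorm_ge0.
have qkij i j : modulus ((q ^+ k) i j) <= opnorm q ^+ k.
  have -> : (q ^+ k) i j = (q ^+ k *m delta_mx j 0 : 'cV_2) i 0.
    by rewrite -colE mxE.
  apply: le_trans (ler_modulus_l2norm _ _) _; apply: le_trans (qk _) _.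
  suff -> : l2norm (delta_mx j 0 : 'cV[Cplx R]_2) = 1 by rewrite mulr1.
  rewrite /l2norm (bigD1 j) //= big1 => [|i' /negPf i'j]; rewrite mxE.
    by rewrite !eqxx modulus1 expr1n addr0 sqrtr1.
  by rewrite i'j modulus0 expr0n.
by rewrite /mxnorm1 !big_ord_recl !big_ord0 !addr0 -[4%N]/(2 * 2)%N mulrnA
  ![_ *+ 2]mulr2n !lerD.
Qed.

End OperatorNorm.

(** * The algebra H_t *)

Section QuaternionAlgebra.
Variables (R : realType) (t : R).
Hypothesis t0 : t != 0.
Implicit Types (p q x : 'M[Cplx R]_2) (u : nat -> 'M[Cplx R]_2).

Let tC : Cplx R := (t%:C)%C.

Let tC0 : tC != 0.
Proof. by rewrite /tC -[0]/((0 : R)%:C)%C (inj_eq (@complexI R)). Qed.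

Let D2 (a b : Cplx R) : 'M[Cplx R]_2 :=
  \matrix_(i, j) if i == j then (if i == 0 then a else b) else 0.

Let A2 (a b : Cplx R) : 'M[Cplx R]_2 :=
  \matrix_(i, j) if i == j then 0 else (if i == 0 then a else b).

Let mx2P p q : p 0 0 = q 0 0 -> p 0 1 = q 0 1 -> p 1 0 = q 1 0 ->
  p 1 1 = q 1 1 -> p = q.
Proof.
move=> e00 e01 e10 e11; apply/matrixP => i j.
have I2 (k : 'I_2) : k = 0 \/ k = 1.
  by case: k => [[|[|k]] //] Hk; [left|right]; apply: val_inj.
by case: (I2 i) => ->; case: (I2 j) => ->.
Qed.

Let mulmx2E p q i j : (p * q) i j = p i 0 * q 0 j + p i 1 * q 1 j.
Proof.
rewrite -mulmxE mxE !big_ord_recl big_ord0 addr0.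
by congr (_ * _ + p _ _ * q _ _); apply: val_inj.
Qed.

Let mulmx2_inv p q : p * q = 1 -> p^-1 = q.
Proof.
move=> pq; have [pU _] := mulmx1_unit pq.
by rewrite -[LHS]mulr1 -pq mulrA mulVr ?mul1r.
Qed.

(* On [Ht t] the involution [hstar t] is [q |-> D q^T D^-1] with
   [D = diag (t, 1)], which is an anti-automorphism of the whole matrix ring. *)
Definition mxstar q := D2 tC 1 * q^T * D2 tC^-1 1.

(* [Ht t] is the fixed ring of the conjugate-linear automorphism
   [q |-> J (conj q) J^-1] with [J = ((0, t), (1, 0))]. *)
Definition mxtwist q := A2 tC 1 * map_mx Num.conj q * A2 1 tC^-1.

Let D2K : D2 tC^-1 1 * D2 tC 1 = 1.
Proof. by apply: mx2P; rewrite !mulmx2E !mxE /= ?mulVf //; ring. Qed.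

Let D2VK : D2 tC 1 * D2 tC^-1 1 = 1.
Proof. by apply: mx2P; rewrite !mulmx2E !mxE /= ?mulfV //; ring. Qed.

Let A2K : A2 1 tC^-1 * A2 tC 1 = 1.
Proof. by apply: mx2P; rewrite !mulmx2E !mxE /= ?mulVf //; ring. Qed.

Let A2VK : A2 tC 1 * A2 1 tC^-1 = 1.
Proof. by apply: mx2P; rewrite !mulmx2E !mxE /= ?mulfV //; ring. Qed.

Lemma mxstarB : {morph mxstar : p q / p - q}.
Proof. by move=> p q; rewrite /mxstar linearB /= mulrBr mulrBl. Qed.

Lemma mxstarD : {morph mxstar : p q / p + q}.
Proof. by move=> p q; rewrite /mxstar linearD /= mulrDr mulrDl. Qed.

Lemma mxstarM p q : mxstar (p * q) = mxstar q * mxstar p.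
Proof.
rewrite /mxstar -mulmxE trmx_mul mulmxE !mulrA.
by rewrite -[_ * D2 tC^-1 1 * D2 tC 1]mulrA D2K mulr1.
Qed.

Lemma mxstar0 : mxstar 0 = 0.
Proof. by rewrite /mxstar trmx0 mulr0 mul0r. Qed.

Lemma mxstar1 : mxstar 1 = 1.
Proof. by rewrite /mxstar trmx1 mulr1 D2VK. Qed.

Lemma mxstarX q k : mxstar (q ^+ k) = mxstar q ^+ k.
Proof.
by elim: k => [|k IH]; rewrite ?expr0 ?mxstar1 // exprSr mxstarM IH -exprS.
Qed.

Lemma mxstarK : involutive mxstar.
Proof.
have tr2 a b : (D2 a b)^T = D2 a b by apply: mx2P; rewrite !mxE.
move=> q; rewrite /mxstar -!mulmxE !trmx_mul trmxK !tr2 !mulmxA !mulmxE.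
by rewrite D2VK mul1r -mulrA D2VK mulr1.
Qed.

Lemma mxstarV q : q \is a GRing.unit -> mxstar q^-1 = (mxstar q)^-1.
Proof.
by move=> qU; apply/esym/mulmx2_inv; rewrite -mxstarM mulVr // mxstar1.
Qed.

Lemma hstarE q : Ht t q -> hstar t q = mxstar q.
Proof.
move=> [a [b ->]].
by apply: mx2P; rewrite /mxstar !mulmx2E !mxE /= /hcoefa /hcoefb !mxE /=
  ?conjCK -?/tC; field.
Qed.

Lemma mxtwistB : {morph mxtwist : p q / p - q}.
Proof. by move=> p q; rewrite /mxtwist map_mxB /= mulrBr mulrBl. Qed.

Lemma mxtwistD : {morph mxtwist : p q / p + q}.
Proof. by move=> p q; rewrite /mxtwist map_mxD /= mulrDr mulrDl. Qed.

Lemma mxtwistM : {morph mxtwist : p q / p * q}.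
Proof.
move=> p q; rewrite /mxtwist -mulmxE map_mxM mulmxE !mulrA.
by rewrite -[_ * A2 1 tC^-1 * A2 tC 1]mulrA A2K mulr1.
Qed.

Lemma mxtwist1 : mxtwist 1 = 1.
Proof. by rewrite /mxtwist map_mx1 mulr1 A2VK. Qed.

(** Membership becomes a fixed-point equation, so closure under sums, products, inverses and limits
    follows from the algebra and continuity of [mxtwist]. *)
Lemma HtP q : Ht t q <-> mxtwist q = q.
Proof.
(* [t] is real, so conjugation fixes it. *)
have conjt : tC^* = tC by apply: (CrealP _); rewrite complex_real.
split=> [[a [b ->]]|].
  by apply: mx2P; rewrite /mxtwist !mulmx2E !mxE /= -?/tC ?rmorphM /= ?conjt
    ?conjCK; field.
move=> qE; exists (q 0 0), (q 1 0)^*.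
have e i j := congr1 (fun m : 'M[Cplx R]_2 => m i j) qE.
apply: mx2P; rewrite !mxE /= -?/tC ?conjCK // -[LHS]e /mxtwist !mulmx2E !mxE /=;
  ring.
Qed.

Lemma Ht0 : Ht t 0.
Proof. by apply/HtP; rewrite -(subrr 0) mxtwistB !subrr. Qed.

Lemma Ht1 : Ht t 1.
Proof. by apply/HtP; exact: mxtwist1. Qed.

Lemma HtD p q : Ht t p -> Ht t q -> Ht t (p + q).
Proof. by move=> /HtP pE /HtP qE; apply/HtP; rewrite mxtwistD pE qE. Qed.

Lemma HtB p q : Ht t p -> Ht t q -> Ht t (p - q).
Proof. by move=> /HtP pE /HtP qE; apply/HtP; rewrite mxtwistB pE qE. Qed.

Lemma HtM p q : Ht t p -> Ht t q -> Ht t (p * q).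
Proof. by move=> /HtP pE /HtP qE; apply/HtP; rewrite mxtwistM pE qE. Qed.

Lemma HtX q k : Ht t q -> Ht t (q ^+ k).
Proof.
by move=> Hq; elim: k => [|k IH]; rewrite ?expr0 ?exprS; [exact: Ht1|exact: HtM].
Qed.

Lemma HtV q : q \is a GRing.unit -> Ht t q -> Ht t q^-1.
Proof.
move=> qU /HtP qE; apply/HtP/esym/mulmx2_inv.
by rewrite -{1}qE -mxtwistM mulrV // mxtwist1.
Qed.

Lemma Ht_mxstar q : Ht t q -> Ht t (mxstar q).
Proof. by move=> Hq; rewrite -hstarE //; exists (hcoefa q), (hcoefb q)^*. Qed.

Lemma mxnorm1_mxstar :
  exists2 C, 0 <= C & forall q, mxnorm1 (mxstar q) <= C * mxnorm1 q.
Proof.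
exists (mxnorm1 (D2 tC 1) * mxnorm1 (D2 tC^-1 1)).
  by rewrite mulr_ge0 ?mxnorm1_ge0.
move=> q; rewrite mulrAC; apply: le_trans (ler_mxnorm1M _ _) _.
rewrite ler_wpM2r ?mxnorm1_ge0 //; apply: le_trans (ler_mxnorm1M _ _) _.
rewrite ler_wpM2l ?mxnorm1_ge0 // /mxnorm1 exchange_big /=.
by apply: ler_sum => i _; apply: ler_sum => j _; rewrite mxE.
Qed.

Lemma mxnorm1_mxtwist :
  exists2 C, 0 <= C & forall q, mxnorm1 (mxtwist q) <= C * mxnorm1 q.
Proof.
exists (mxnorm1 (A2 tC 1) * mxnorm1 (A2 1 tC^-1)).
  by rewrite mulr_ge0 ?mxnorm1_ge0.
move=> q; rewrite mulrAC; apply: le_trans (ler_mxnorm1M _ _) _.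
rewrite ler_wpM2r ?mxnorm1_ge0 //; apply: le_trans (ler_mxnorm1M _ _) _.
rewrite ler_wpM2l ?mxnorm1_ge0 // /mxnorm1.
by apply: ler_sum => i _; apply: ler_sum => j _; rewrite mxE modulusJ.
Qed.

Lemma Ht_lim u L : (forall k, Ht t (u k)) -> u @ \oo --> L -> Ht t L.
Proof.
move=> Hu uL; apply/HtP; have [C _ HC] := mxnorm1_mxtwist.
apply: (mx_cvg_unique _ uL).
have -> : u = mxtwist \o u by apply/funext => k /=; apply/esym/HtP.
exact: (cvg_mx_bounded_map mxtwistB HC).
Qed.

End QuaternionAlgebra.

(** * Power series and square summability *)

Section StarProduct.
Variable R : realType.
Implicit Types (f g u : hseries R) (c : 'M[Cplx R]_2).

Lemma star_mul_hmonol m c g n :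
  star_mul (hmono m c) g n = if (m <= n)%N then c * g (n - m)%N else 0.
Proof.
transitivity (\sum_(k < n.+1 | k == (n - m)%N :> nat)
    (if (m <= n)%N then c * g k else 0)).
  rewrite [RHS]big_mkcond; apply: eq_bigr => k _.
  rewrite /hmono; have := ltn_ord k; rewrite ltnS => kn.
  (* Only [k = n - m] contributes; the guard [m <= n] is needed because subtraction truncates at
     zero. *)
  have -> : ((n - k)%N == m) = (m <= n)%N && (k == (n - m)%N :> nat) by lia.
  by case: leqP => _ /=; case: eqP; rewrite ?mul0r.
rewrite (big_ord1_eq _ (fun k => if (m <= n)%N then c * g k else 0)).
by rewrite ltnS leq_subr.
Qed.

Lemma star_mul_hmonor m c f n :
  star_mul f (hmono m c) n = if (m <= n)%N then f (n - m)%N * c else 0.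
Proof.
transitivity (\sum_(k < n.+1 | k == m :> nat) f (n - k)%N * c).
  rewrite [RHS]big_mkcond; apply: eq_bigr => k _.
  by rewrite /hmono; case: eqP; rewrite ?mulr0.
by rewrite (big_ord1_eq _ (fun k => f (n - k)%N * c)) ltnS.
Qed.

Lemma star_mulBl f g h n :
  star_mul (f \- g) h n = star_mul f h n - star_mul g h n.
Proof.
by rewrite /star_mul -sumrB; apply: eq_bigr => k _; rewrite mulrBl.
Qed.

Lemma star_mulBr f g h n :
  star_mul f (g \- h) n = star_mul f g n - star_mul f h n.
Proof.
by rewrite /star_mul -sumrB; apply: eq_bigr => k _; rewrite mulrBr.
Qed.

(** Multiplication by the variable; the value 0 at index 0 encodes the convention that the
    coefficient of index -1 vanishes. *)
Definition hshift u : hseries R := fun n => if n is m.+1 then u m else 0.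

Lemma star_mul_shift u n : star_mul (hmono 1%N 1) u n = hshift u n.
Proof.
by rewrite star_mul_hmonol; case: n => //= n; rewrite mul1r subn1.
Qed.

(** The geometric series is a two-sided inverse, so [get] returns some inverse [h]; reading the
    equation for [h] coefficientwise forces [h 0 = 1] and [h n.+1 = c * h n]. *)
Lemma star_inv_linear c n :
  star_inv (hmono 0%N 1 \- hmono 1%N c) n = c ^+ n.
Proof.
have [inv1 _] : [set g | star_mul (hmono 0%N 1 \- hmono 1%N c) g = hmono 0%N 1 /\
    star_mul g (hmono 0%N 1 \- hmono 1%N c) = hmono 0%N 1]
    (star_inv (hmono 0%N 1 \- hmono 1%N c)).
  apply: (@getPex _ _); exists (fun k => c ^+ k).
  split; apply/funext => -[|k].
  - by rewrite star_mulBl !star_mul_hmonol /= mul1r subr0 subnn expr0.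
  - by rewrite star_mulBl !star_mul_hmonol /= mul1r subn0 subn1 -exprS subrr.
  - by rewrite star_mulBr !star_mul_hmonor /= mulr1 subr0 subnn expr0.
  - by rewrite star_mulBr !star_mul_hmonor /= mulr1 subn0 subn1 -exprSr subrr.
elim: n => [|n IH].
  have := congr1 (fun s : hseries R => s 0%N) inv1.
  by rewrite star_mulBl !star_mul_hmonol /= mul1r subr0 subnn expr0.
have := congr1 (fun s : hseries R => s n.+1) inv1.
rewrite star_mulBl !star_mul_hmonol /= mul1r subn0 subn1 /= IH -exprS.
by move/eqP; rewrite subr_eq0 => /eqP.
Qed.

Lemma hshift_sum f g n :
  \sum_(k < n.+1) hshift f (n - k)%N * g k =
  hshift (fun m => \sum_(k < m.+1) f (m - k)%N * g k) n.
Proof.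
case: n => [|n]; first by rewrite big_ord_recl big_ord0 /= mul0r addr0.
(* The last term contains [hshift f 0 = 0]. *)
rewrite big_ord_recr /= subnn mul0r addr0; apply: eq_bigr => k _.
by rewrite subSn // -ltnS ltn_ord.
Qed.

End StarProduct.

(** * Square-summable sequences and their geometrically weighted tails *)

Section SquareSummable.
Variable R : realType.
Implicit Types a x : R^nat.

Lemma geometric_sum_le (r : R) n : 0 <= r < 1 ->
  \sum_(k < n) r ^+ k <= (1 - r)^-1.
Proof.
move=> /andP[r0 r1]; have r1' : 0 < 1 - r by rewrite subr_gt0.
rewrite -[leRHS]mul1r ler_pdivlMr // mulrC.
have := subrX1 r n; rewrite -[1 - r]opprB mulNr => <-.
by rewrite opprB gerBl exprn_ge0.
Qed.

(** Each [a n] is at most [1 + a n ^+ 2], and the square is at most the whole sum. *)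
Lemma cvg_series_sqr_bounded a : cvgn (series (fun n => a n ^+ 2)) ->
  exists B, forall n, a n <= B.
Proof.
move=> ca; exists (1 + limn (series (fun n => a n ^+ 2))) => n.
have ndS : nondecreasing_seq (series (fun n => a n ^+ 2)).
  by apply: nondecreasing_series => k _ _; exact: sqr_ge0.
have := nondecreasing_cvgn_le ndS ca n.+1.
have S0 : 0 <= series (fun n => a n ^+ 2) n.
  by rewrite seriesEnat /=; apply: sumr_ge0 => k _; exact: sqr_ge0.
rewrite seriesSr; nra.
Qed.

Lemma ge0_series_cvg_bounded a B : (forall n, 0 <= a n) ->
  (forall n, series a n <= B) -> cvgn (series a).
Proof.
move=> a0 aB; apply: nondecreasing_is_cvgn.
  by apply: nondecreasing_series => k _ _; exact: a0.
by exists B => _ [n _ <-].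
Qed.

(** The witness is the tail [x n], the sum over [k] of [r ^+ k * a (n + k)]. The recursion
    [x n = a n + r * x n.+1] and convexity of the square bound the sum of squares by a multiple
    [r < 1] of itself plus a constant. *)
Lemma geometric_tail_sqr_summable a (r : R) : 0 <= r < 1 ->
    (forall n, 0 <= a n) -> cvgn (series (fun n => a n ^+ 2)) ->
  exists x, [/\ forall n, 0 <= x n,
    forall n N, \sum_(k < N) r ^+ k * a (n + k)%N <= x n &
    cvgn (series (fun n => x n ^+ 2))].
Proof.
move=> r01 a0 ca; have /andP[r0 r1] := r01.
have r1' : 0 < 1 - r by rewrite subr_gt0.
have [B aB] := cvg_series_sqr_bounded ca.
pose s n := series (fun k => r ^+ k * a (n + k)%N).
have sC n : cvgn (s n).
  apply: (@series_le_geometric_cvg _ _ B r) => // k.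
  by rewrite ger0_norm ?mulr_ge0 ?exprn_ge0 // mulrC ler_wpM2r ?exprn_ge0.
have sN n : nondecreasing_seq (s n).
  by apply: nondecreasing_series => k _ _; rewrite mulr_ge0 ?exprn_ge0.
pose x n := limn (s n).
have sx n N : s n N <= x n by exact: nondecreasing_cvgn_le.
have x0 n : 0 <= x n by have := sx n 0; rewrite /s seriesEnat /= big_geq.
have xS n : x n = a n + r * x n.+1.
  have x1 : s n N.+1 @[N --> \oo] --> x n.
    by rewrite (cvg_shiftS (s n)); exact: sC.
  rewrite -(cvg_lim (@Rhausdorff _) x1); apply: cvg_lim; first exact: Rhausdorff.
  have -> : (fun N => s n N.+1) = (fun N => a n + r * s n.+1 N).
    apply/funext => N; rewrite /s !seriesEnat /=.
    rewrite big_nat_recl // expr0 mul1r addn0.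
    rewrite mulr_sumr; congr (_ + _); apply: eq_bigr => k _.
    by rewrite exprS mulrA addSnnS.
  by apply: cvgD; [exact: cvg_cst|apply: cvgM; [exact: cvg_cst|exact: sC]].
(* This crude bound later controls the boundary term [x N] of the shifted sum. *)
have xB n : x n <= B * (1 - r)^-1.
  apply: limr_le; first exact: sC.
  apply: nearW => N; rewrite /s seriesEord /=.
  have B0 : 0 <= B by exact: le_trans (a0 0) (aB 0).
  apply: (@le_trans _ _ (B * \sum_(k < N) r ^+ k)).
    rewrite mulr_sumr; apply: ler_sum => k _.
    by rewrite mulrC ler_wpM2r ?exprn_ge0.
  by rewrite ler_wpM2l // geometric_sum_le.
exists x; split=> // [n N|].
  by have := sx n N; rewrite /s seriesEord.
set A := limn (series (fun n => a n ^+ 2)).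
have aA n : series (fun n => a n ^+ 2) n <= A.
  apply: nondecreasing_cvgn_le => //.
  by apply: nondecreasing_series => k _ _; exact: sqr_ge0.
pose c := (1 - r)^-1.
(* Convexity of the square at [x n = (1 - r) (a n / (1 - r)) + r (x n.+1)]. *)
have xx n : x n ^+ 2 <= c * a n ^+ 2 + r * x n.+1 ^+ 2.
  have c0 : 0 < c by rewrite invr_gt0.
  have rc : (1 - r) * c = 1 by rewrite mulfV // gt_eqF.
  rewrite {1}xS -subr_ge0.
  have -> : c * a n ^+ 2 + r * x n.+1 ^+ 2 - (a n + r * x n.+1) ^+ 2 =
    r * (1 - r) * (c * a n - x n.+1) ^+ 2.
    have -> : r * (1 - r) * (c * a n - x n.+1) ^+ 2 =
      r * ((1 - r) * c) * c * a n ^+ 2 - r * ((1 - r) * c) * a n * x n.+1 *+ 2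
      + r * (1 - r) * x n.+1 ^+ 2 by ring.
    have -> : c * a n ^+ 2 = ((1 - r) * c + r * c) * a n ^+ 2 by ring.
    by rewrite rc; ring.
  by apply: mulr_ge0; [rewrite mulr_ge0 // ltW|exact: sqr_ge0].
(* Let [S] be a partial sum of the squares of [x]. Summing [xx], and bounding the shifted sum by
   [S + (B * c) ^+ 2], gives [(1 - r) * S <= c * A + r * (B * c) ^+ 2]. *)
pose X := (c * A + r * (B * c) ^+ 2) * c.
apply: (@ge0_series_cvg_bounded _ X) => [n|N]; first exact: sqr_ge0.
rewrite /X ler_pdivlMr //.
have S1 : series (fun n => x n ^+ 2) N <=
    c * series (fun n => a n ^+ 2) N + r * series (fun n => x n.+1 ^+ 2) N.
  rewrite !seriesEnat /= !mulr_sumr -big_split /=; apply: ler_sum => k _.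
  exact: xx.
have S2 : series (fun n => x n.+1 ^+ 2) N <=
    series (fun n => x n ^+ 2) N + (B * c) ^+ 2.
  apply: (@le_trans _ _ (series (fun n => x n ^+ 2) N.+1)).
    rewrite !seriesEnat /= big_nat_recl //= lerDr; exact: sqr_ge0.
  by rewrite seriesSr lerD2l ler_sqr ?nnegrE ?xB // (le_trans (x0 N)) ?xB.
have S3 : c * series (fun n => a n ^+ 2) N <= c * A.
  by rewrite ler_wpM2l ?aA // invr_ge0 ltW.
have S4 := ler_wpM2l r0 S2.
lra.
Qed.

End SquareSummable.

(** * Ring identities derived from the equation [G = 1 + a * G * s] *)

Section SteinEquation.
Variables (A : unitRingType) (a s G : A).
Hypothesis GU : G \is a GRing.unit.
Hypothesis GE : G = 1 + a * G * s.

Let b := G * s * G^-1.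
Let P := G^-1 + s * a.

Let GE' : a * (G * s) = G - 1.
Proof. by rewrite [in RHS]GE addrAC subrr add0r mulrA. Qed.

(** With [b * G = G * s] and [a * (G * s) = G - 1], the product expands to [1 + G * s * a - (b * a +
    (G * s * a - b * a))]. *)
Lemma stein_mulLP : (G - G * s * G^-1 * a * G) * P = 1.
Proof.
have bG : b * G = G * s by rewrite /b -mulrA mulVr // mulr1.
rewrite -/b mulrBl !mulrDr mulrV //.
have -> : b * a * G * G^-1 = b * a by rewrite -mulrA mulrV // mulr1.
have -> : b * a * G * (s * a) = G * s * a - b * a.
  have -> : b * a * G * (s * a) = b * (a * (G * s)) * a by rewrite !mulrA.
  by rewrite GE' mulrBr mulr1 bG mulrBl.
by rewrite mulrA [b * a + _]addrC subrK addrK.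
Qed.

Lemma stein_mulPb : P * b = s.
Proof.
have -> : P * b = G^-1 * (G * s) * G^-1 + s * (a * (G * s)) * G^-1.
  by rewrite /P /b mulrDl !mulrA.
by rewrite mulKr // GE' mulrBr mulr1 mulrBl mulrK // addrC subrK.
Qed.

(** The image of [b] under an anti-automorphic involution that exchanges [a] and [s] and fixes [G];
    the ring carries no involution here, so it is written out. *)
Let b' := G^-1 * a * G.

Lemma stein_mulbP : b' * P = a.
Proof.
have -> : b' * P = G^-1 * a * (G * G^-1) + G^-1 * (a * (G * s)) * a.
  by rewrite /P /b' mulrDr !mulrA.
by rewrite mulrV // mulr1 GE' mulrBr mulr1 mulVr // mulrBl mul1r addrC subrK.
Qed.

(* The difference of the two squares telescopes along a sequence, with
   [v] the predecessor of [u]. *)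
Lemma stein_telescope (u v su sv : A) :
  (su - sv * b') * (P * (u - b * v)) - (sv - su * s) * (v - a * u) =
  su * G^-1 * u - sv * G^-1 * v.
Proof.
have b's : b' * s = 1 - G^-1.
  have -> : b' * s = G^-1 * (a * (G * s)) by rewrite /b' !mulrA.
  by rewrite GE' mulrBr mulr1 mulVr.
have -> : P * (u - b * v) = P * u - s * v.
  by rewrite mulrBr [P * (b * v)]mulrA stein_mulPb.
have -> : (su - sv * b') * (P * u - s * v) =
    su * G^-1 * u + su * s * a * u - su * s * v -
    (sv * a * u - (sv * v - sv * G^-1 * v)).
  rewrite mulrBl !mulrBr /P mulrDl mulrDr.
  rewrite -[sv * b' * (s * v)]mulrA [b' * (s * v)]mulrA b's mulrBl mul1r mulrBr.
  rewrite -[sv * b' * _]mulrA -mulrDl -/P [b' * (P * u)]mulrA stein_mulbP.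
  by rewrite !mulrA.
have -> : (sv - su * s) * (v - a * u) =
    sv * v - sv * a * u - (su * s * v - su * s * a * u).
  by rewrite mulrBl !mulrBr !mulrA.
(* The six monomials become opaque, and only a commutative cancellation in the additive group
   remains. *)
move: (su * G^-1 * u) (su * s * a * u) (su * s * v) (sv * a * u) (sv * v)
  (sv * G^-1 * v) => x1 x2 x3 x4 x5 x6.
rewrite !opprB !addrA.
rewrite (ACl (1 * 5 * (2 * 8) * (3 * 7) * (4 * 10) * (6 * 9)))%AC /=.
by rewrite !subrr !addNr !addr0.
Qed.

End SteinEquation.

(** * The Hardy space and its form in terms of the entry norm *)

Lemma le_series_cvgZ (R : realType) (a b : R^nat) C : 0 <= C ->
    (forall n, 0 <= a n) -> (forall n, 0 <= b n) ->
    (forall n, a n <= C * b n) ->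
  cvgn (series b) -> cvgn (series a).
Proof.
move=> C0 a0 b0 ab cb.
apply: (@ge0_series_cvg_bounded _ _ (C * limn (series b))) => // n.
apply: (@le_trans _ _ (C * series b n)).
  by rewrite !seriesEnat /= mulr_sumr; apply: ler_sum => k _; exact: ab.
rewrite ler_wpM2l // nondecreasing_cvgn_le //.
by apply: nondecreasing_series => k _ _; exact: b0.
Qed.

Lemma ler_Re_mxtrace (R : realType) n (q : 'M[Cplx R]_n) :
  `|complex.Re (\tr q)| <= mxnorm1 q.
Proof.
rewrite (le_trans (ler_Re_modulus _)) // /mxtrace /mxnorm1.
elim/big_rec2 : _ => [|i x y _ IH]; first by rewrite modulus0.
rewrite (le_trans (ler_modulusD _ _)) // lerD // (bigD1 i) //= lerDl.
by apply: sumr_ge0 => j _; exact: modulus_ge0.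
Qed.

Lemma Re_mxtraceB (R : realType) n (p q : 'M[Cplx R]_n) :
  complex.Re (\tr (p - q)) = complex.Re (\tr p) - complex.Re (\tr q).
Proof. by rewrite linearB /=; case: (\tr p) (\tr q) => ? ? []. Qed.

Lemma is_cvg_series_shiftS (R : realType) (a : R^nat) :
  cvgn (series a) -> cvgn (series (fun n => a n.+1)).
Proof.
move=> ca.
have -> : series (fun n => a n.+1) = (fun n => series a n.+1) - cst (a 0%N).
  by apply/funext => n; rewrite !seriesEnat !fctE /= big_nat_recl // addrC addKr.
apply: is_cvgB; last exact: is_cvg_cst.
by apply/cvg_ex; exists (limn (series a)); rewrite (cvg_shiftS (series a)).
Qed.

Section Hardy.
Variables (R : realType) (t : R).
Hypothesis t0 : t != 0.
Implicit Types (q : 'M[Cplx R]_2) (f : hseries R).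

Lemma hnormE_equiv_mxnorm1 : exists2 C, 0 <= C & forall q, Ht t q ->
  mxnorm1 q ^+ 2 <= C * hnormE t q ^+ 2 /\ hnormE t q ^+ 2 <= C * mxnorm1 q ^+ 2.
Proof.
have tp : 0 < `|t| by rewrite normr_gt0.
(* With [x], [y] the moduli of [a], [b], the entry norm is [2 * x + (1 + |t|) * y], whose square is
   at most [8 * x ^+ 2 + 2 * (1 + |t|) ^+ 2 * y ^+ 2]; the first two summands absorb this. The
   converse inequality needs only [1 + |t| <= C]. *)
pose C := 8 + 2 * (1 + `|t|) ^+ 2 * `|t|^-1 + `|t|.
have V0 : 0 < `|t|^-1 by rewrite invr_gt0.
have W0 : 0 <= (1 + `|t|) ^+ 2 * `|t|^-1 by rewrite mulr_ge0 ?sqr_ge0 ?ltW.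
exists C => [|_ [a [b ->]]]; first by rewrite /C; lra.
rewrite /hnormE sqr_sqrtr; last first.
  by rewrite addr_ge0 ?sqr_ge0 // mulr_ge0 ?sqr_ge0.
rewrite /mxnorm1 !big_ord_recl !big_ord0 /hcoefa /hcoefb !mxE /=.
rewrite conjCK !modulusJ modulusM modulusC !addr0.
have := modulus_ge0 a; have := modulus_ge0 b.
move: (modulus a) (modulus b) => x y y0 x0.
have -> : x + `|t| * y + (y + x) = 2 * x + (1 + `|t|) * y by ring.
split.
  apply: (@le_trans _ _ (8 * x ^+ 2 + 2 * (1 + `|t|) ^+ 2 * y ^+ 2)).
    rewrite -subr_ge0; have -> : 8 * x ^+ 2 + 2 * (1 + `|t|) ^+ 2 * y ^+ 2 -
      (2 * x + (1 + `|t|) * y) ^+ 2 = (2 * x - (1 + `|t|) * y) ^+ 2 by ring.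
    exact: sqr_ge0.
  rewrite -subr_ge0.
  have -> : C * (x ^+ 2 + `|t| * y ^+ 2) -
      (8 * x ^+ 2 + 2 * (1 + `|t|) ^+ 2 * y ^+ 2) =
    (2 * (1 + `|t|) ^+ 2 * `|t|^-1 + `|t|) * x ^+ 2 + (8 + `|t|) * `|t| * y ^+ 2
     + 2 * (1 + `|t|) ^+ 2 * (`|t|^-1 * `|t| - 1) * y ^+ 2 by rewrite /C; ring.
  rewrite mulVf ?gt_eqF // subrr mulr0 mul0r addr0.
  by rewrite addr_ge0 // mulr_ge0 ?sqr_ge0 //; nra.
have xx : x ^+ 2 <= (2 * x + (1 + `|t|) * y) ^+ 2.
  rewrite ler_sqr ?nnegrE //; nra.
have yy : y ^+ 2 <= (2 * x + (1 + `|t|) * y) ^+ 2.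
  rewrite ler_sqr ?nnegrE //; nra.
have zz := sqr_ge0 (2 * x + (1 + `|t|) * y).
move: ((2 * x + (1 + `|t|) * y) ^+ 2) xx yy zz => z xx yy zz.
apply: (@le_trans _ _ ((1 + `|t|) * z)); first nra.
by rewrite ler_wpM2r // /C; lra.
Qed.

Lemma hardy2P f : hardy2 t f <->
  (forall n, Ht t (f n)) /\ cvgn (series (fun n => mxnorm1 (f n) ^+ 2)).
Proof.
have [C C0 HC] := hnormE_equiv_mxnorm1.
split=> -[fH fs]; split=> //.
  apply: (le_series_cvgZ C0 _ _ _ fs) => n; rewrite ?sqr_ge0 //.
  by have [] := HC _ (fH n).
apply: (le_series_cvgZ C0 _ _ _ fs) => n; rewrite ?sqr_ge0 //.
by have [] := HC _ (fH n).
Qed.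

(** The terms have no fixed sign, so convergence is absolute, by comparison with the squared entry
    norms. *)
Lemma hform_cvg f : hardy2 t f ->
  cvgn (series (fun n => complex.Re (\tr (hstar t (f n) * f n)))).
Proof.
move=> /hardy2P[fH fs]; apply: normed_cvg.
have [C C0 HC] := mxnorm1_mxstar t.
apply: (le_series_cvgZ C0 _ _ _ fs) => n; rewrite /= ?sqr_ge0 //.
rewrite (le_trans (ler_Re_mxtrace _)) // (le_trans (ler_mxnorm1M _ _)) //.
by rewrite expr2 mulrA ler_wpM2r ?mxnorm1_ge0 // hstarE.
Qed.

End Hardy.

(** * Division by the Blaschke factor *)

Section BlaschkeFactor.
Variables (R : realType) (t : R) (alpha K : 'M[Cplx R]_2).
Hypothesis t0 : t != 0.
Hypothesis alphaH : Ht t alpha.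
Hypothesis alpha1 : opnorm alpha < 1.
Implicit Types (f g : hseries R).

Let r := opnorm alpha.
Let alphas := mxstar t alpha.
Let G := Gamma_op t alpha.
Let b := G * alphas * G^-1.
Let P := G^-1 + alphas * alpha.

Let r01 : 0 <= r < 1.
Proof. by rewrite opnorm_ge0. Qed.

(** The involution may enlarge the operator norm, but it is bounded and commutes with powers, so the
    decay rate [r] of [alpha] is kept. *)
Lemma mxnorm1_mxstar_exp :
  exists2 C, 0 <= C & forall k, mxnorm1 (alphas ^+ k) <= C * r ^+ k.
Proof.
have [C C0 HC] := mxnorm1_mxstar t.
exists (C * 4) => [|k]; first by rewrite mulr_ge0.
rewrite -mxstarX // (le_trans (HC _)) // -mulrA ler_wpM2l //.
by rewrite mulrC mulr_natr ler_mxnorm1_exp_opnorm.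
Qed.

Lemma Gamma_cvg :
  series (fun n => alpha ^+ n * alphas ^+ n) @ \oo --> G.
Proof.
rewrite /G /Gamma_op (hstarE t0 alphaH) -/alphas.
have [C C0 HC] := mxnorm1_mxstar_exp.
have /andP[r0 r1] := r01.
have [|L HL] :=
    @mx_series_cvg _ _ (fun n => alpha ^+ n * alphas ^+ n) (C *+ 4) r r01.
  move=> k; rewrite (le_trans (ler_mxnorm1M _ _)) //.
  rewrite mulrnAl -mulrnAr [leRHS]mulrC; apply: ler_pM; rewrite ?mxnorm1_ge0 //.
    exact: ler_mxnorm1_exp_opnorm.
  by rewrite (le_trans (HC _)) // ler_piMr ?exprn_ile1 // ltW.
by rewrite (mx_cvg_lim HL).
Qed.

(** Splitting off the term of index 0 expresses each partial sum through the preceding one; both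
    sides then pass to the limit. *)
Lemma GammaE : G = 1 + alpha * G * alphas.
Proof.
have phi q : mxnorm1 (alpha * q * alphas) <=
    mxnorm1 alpha * mxnorm1 alphas * mxnorm1 q.
  rewrite mulrAC (le_trans (ler_mxnorm1M _ _)) // ler_wpM2r ?mxnorm1_ge0 //.
  exact: ler_mxnorm1M.
have phiB : {morph (fun q => alpha * q * alphas) : p q / p - q}.
  by move=> p q; rewrite mulrBr mulrBl.
have cG := cvg_mx_bounded_map phiB phi Gamma_cvg.
have := Gamma_cvg; rewrite -cvg_shiftS /= => /mx_cvg_unique; apply.
have -> : (fun n => series (fun n => alpha ^+ n * alphas ^+ n) n.+1) =
    (fun n => 1 + alpha * series (fun n => alpha ^+ n * alphas ^+ n) n * alphas).
  apply/funext => n; rewrite !seriesEnat /= big_nat_recl //= !expr0 mulr1.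
  congr (_ + _); rewrite mulr_sumr mulr_suml; apply: eq_bigr => k _.
  by rewrite exprS exprSr !mulrA.
by apply: cvgD; [exact: cvg_cst|exact: cG].
Qed.

Lemma Ht_sum n (F : nat -> 'M[Cplx R]_2) :
  (forall k, Ht t (F k)) -> Ht t (\sum_(0 <= k < n) F k).
Proof.
move=> FH; elim/big_ind : _ => [|p q|k _]; [exact: Ht0|exact: HtD|exact: FH].
Qed.

Lemma Ht_Gamma : Ht t G.
Proof.
apply: (Ht_lim t0 _ Gamma_cvg) => n; rewrite seriesEnat /=.
apply: Ht_sum => k; apply: HtM => //; apply: HtX => //.
exact: Ht_mxstar.
Qed.

(** Each term [alpha ^+ n * alphas ^+ n] is fixed by the involution, which is continuous. *)
Lemma mxstar_Gamma : mxstar t G = G.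
Proof.
have [C _ HC] := mxnorm1_mxstar t.
have := cvg_mx_bounded_map (mxstarB t) HC Gamma_cvg.
move=> /mx_cvg_unique; apply.
have -> : (fun k => mxstar t (series (fun n => alpha ^+ n * alphas ^+ n) k)) =
    series (fun n => alpha ^+ n * alphas ^+ n).
  apply/funext => n; rewrite !seriesEnat /=.
  elim: n => [|n IH].
    by rewrite !big_geq // mxstar0.
  rewrite !big_nat_recr //= mxstarD IH; congr (_ + _).
  by rewrite (mxstarM t0) (mxstarX t0 alphas) (mxstarX t0 alpha) (mxstarK t0).
exact: Gamma_cvg.
Qed.

Hypothesis GU : G \is a GRing.unit.

Let bX k : b ^+ k = G * alphas ^+ k * G^-1.
Proof.
elim: k => [|k IH]; first by rewrite !expr0 mulr1 mulrV.
by rewrite exprSr IH exprSr /b !mulrA mulrVK.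
Qed.

(** Being conjugate to [alphas], [b] has powers that decay at the same rate [r], whatever the norm
    of [b] itself. *)
Let mxnorm1_bX : exists2 C, 0 <= C & forall k, mxnorm1 (b ^+ k) <= C * r ^+ k.
Proof.
have [C C0 HC] := mxnorm1_mxstar_exp.
exists (mxnorm1 G * C * mxnorm1 G^-1) => [|k].
  by rewrite !mulr_ge0 ?mxnorm1_ge0.
rewrite bX mulrAC (le_trans (ler_mxnorm1M _ _)) // ler_wpM2r ?mxnorm1_ge0 //.
by rewrite (le_trans (ler_mxnorm1M _ _)) // -mulrA ler_wpM2l ?mxnorm1_ge0.
Qed.

(** The star product of the inverse of [1 - q b] with [K g], that is, the sequence [u] attached to
    [g]. *)
Definition resolvent_sum g : hseries R :=
  fun n => \sum_(k < n.+1) b ^+ (n - k) * (K * g k).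

Lemma resolvent_sumS g n :
  resolvent_sum g n.+1 = b * resolvent_sum g n + K * g n.+1.
Proof.
rewrite /resolvent_sum big_ord_recr /= subnn expr0 mul1r mulr_sumr.
congr (_ + _); apply: eq_bigr => k _.
by rewrite subSn ?exprS ?mulrA // -ltnS ltn_ord.
Qed.

Lemma star_mul_Blaschke g n : star_mul (Blaschke t alpha K) g n =
  hshift (resolvent_sum g) n - alpha * resolvent_sum g n.
Proof.
rewrite /Blaschke (hstarE t0 alphaH) -/alphas -/G -/b.
pose s : hseries R := fun k => b ^+ k.
transitivity (\sum_(k < n.+1)
    (hshift s (n - k)%N * (K * g k) - alpha * (s (n - k)%N * (K * g k)))).
  apply: eq_bigr => k _.
  rewrite star_mul_hmonor leq0n subn0 star_mulBl star_mul_shift.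
  rewrite star_mul_hmonol leq0n subn0 star_inv_linear.
  rewrite -mulrA mulrBl -mulrA; congr (_ * _ - _).
  by case: (n - k)%N => //= m; rewrite star_inv_linear.
by rewrite sumrB -mulr_sumr (hshift_sum s (fun k => K * g k)).
Qed.

Lemma resolvent_sum_bounded g : hardy2 t g ->
  exists B, forall n, mxnorm1 (resolvent_sum g n) <= B.
Proof.
move=> /(hardy2P t0)[_ /cvg_series_sqr_bounded[B gB]].
have [C C0 HC] := mxnorm1_bX.
have B0 : 0 <= B by exact: le_trans (mxnorm1_ge0 _) (gB 0%N).
exists (C * (mxnorm1 K * B) * (1 - r)^-1) => n.
have /andP[r0 _] := r01.
apply: le_trans (ler_mxnorm1_sum _ _ _) _.
apply: (@le_trans _ _ (C * (mxnorm1 K * B) * \sum_(k < n.+1) r ^+ k)).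
  (* Reversing the index matches [r ^+ (n - k)] with the power of [b] in the [k]-th term. *)
  rewrite [X in _ <= _ * X](reindex_inj rev_ord_inj) mulr_sumr /=.
  apply: ler_sum => k _; rewrite subSS mulrAC.
  rewrite (le_trans (ler_mxnorm1M _ _)) // ler_pM ?mxnorm1_ge0 //.
  by rewrite (le_trans (ler_mxnorm1M _ _)) // ler_wpM2l ?mxnorm1_ge0.
by rewrite ler_wpM2l ?geometric_sum_le // !mulr_ge0 ?mxnorm1_ge0.
Qed.

Lemma eval_linear_factor f u B : (forall n, f n = hshift u n - alpha * u n) ->
  (forall n, mxnorm1 (u n) <= B) -> hseries_eval f alpha = 0.
Proof.
move=> fu uB; have B0 : 0 <= B by exact: le_trans (mxnorm1_ge0 _) (uB 0%N).
have /andP[r0 r1] := r01.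
(* The partial sum stops before index [n], hence [hshift u n], which is [u] at [n - 1]; at [n = 0]
   both sides vanish. *)
have sE n : series (fun n => alpha ^+ n * f n) n = - (alpha ^+ n * hshift u n).
  elim: n => [|n IH]; first by rewrite seriesEnat /= big_geq // mulr0 oppr0.
  by rewrite seriesSr IH fu mulrBr addKr exprSr mulrA.
apply: mx_cvg_lim.
apply: (@cvg_mx_le _ _ _ _ (fun n => 4 * B * r ^+ n)) => [n|].
  rewrite sE sub0r opprK (le_trans (ler_mxnorm1M _ _)) // mulrAC.
  rewrite ler_pM ?mxnorm1_ge0 // ?mulr_natl ?ler_mxnorm1_exp_opnorm //.
  by case: n => [|n] /=; rewrite ?mxnorm10.
rewrite -[X in _ --> X](mulr0 (4 * B)); apply: cvgM; first exact: cvg_cst.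
by apply: cvg_expr; rewrite ger0_norm.
Qed.

(* [V n] is the [u_(n-1)] of [f = (q - alpha) * u]. *)
Lemma linear_factor_of_eval0 f : hardy2 t f -> hseries_eval f alpha = 0 ->
  exists V : hseries R, [/\ V 0%N = 0, forall n, f n = V n - alpha * V n.+1,
    forall n, Ht t (V n) & cvgn (series (fun n => mxnorm1 (V n) ^+ 2))].
Proof.
move=> /(hardy2P t0)[fH fs] f0; have /andP[r0 r1] := r01.
have [B fB] := cvg_series_sqr_bounded fs.
(* The scalar tails of the norms of [f] will dominate the matrix tails, up to the factor 4 lost on
   powers of [alpha]. *)
have [x [x0 xf xs]] :=
  geometric_tail_sqr_summable r01 (fun n => mxnorm1_ge0 (f n)) fs.
pose s n := series (fun k => alpha ^+ k * f (n + k)%N).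
have term n k : mxnorm1 (alpha ^+ k * f (n + k)%N) <=
    4 * (r ^+ k * mxnorm1 (f (n + k)%N)).
  rewrite (le_trans (ler_mxnorm1M _ _)) // mulrA ler_wpM2r ?mxnorm1_ge0 //.
  by rewrite mulr_natl ler_mxnorm1_exp_opnorm.
have sV n : s n @ \oo --> limn (s n).
  have [|L HL] :=
      @mx_series_cvg _ _ (fun k => alpha ^+ k * f (n + k)%N) (4 * B) r r01.
    move=> k; rewrite (le_trans (term n k)) // -mulrA ler_wpM2l // mulrC.
    by rewrite ler_wpM2r ?exprn_ge0.
  by rewrite (mx_cvg_lim HL).
pose V n := limn (s n).
exists V; split.
(* The tail starting at 0 is the value of [f] at [alpha]. *)
- by rewrite -f0 /V /s /hseries_eval.
- move=> n; apply/esym/eqP; rewrite subr_eq; apply/eqP.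
  have := sV n; rewrite -cvg_shiftS /= => /mx_cvg_unique; apply.
  have -> : (fun N => s n N.+1) = (fun N => f n + alpha * s n.+1 N).
    apply/funext => N; rewrite /s !seriesEnat /=.
    rewrite big_nat_recl // expr0 mul1r addn0.
    rewrite mulr_sumr; congr (_ + _); apply: eq_bigr => k _.
    by rewrite exprS mulrA addSnnS.
  apply: cvgD; first exact: cvg_cst.
  apply: (@cvg_mx_bounded_map _ _ (fun q => alpha * q) (mxnorm1 alpha)) => //.
    by move=> p q; rewrite mulrBr.
  by move=> q; exact: ler_mxnorm1M.
- move=> n; apply: (Ht_lim t0 _ (sV n)) => N; rewrite /s seriesEnat /=.
  apply: Ht_sum => k; apply: (HtM t0); last exact: fH.
  exact: HtX.
- have Vx n : mxnorm1 (V n) <= 4 * x n.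
    apply: (cvg_mx_mxnorm1_le (sV n)) => N; rewrite /s seriesEord /=.
    apply: le_trans (ler_mxnorm1_sum _ _ _) _.
    apply: (@le_trans _ _ (4 * \sum_(k < N) r ^+ k * mxnorm1 (f (n + k)%N))).
      by rewrite mulr_sumr; apply: ler_sum => k _.
    by rewrite ler_wpM2l.
  apply: (@le_series_cvgZ _ _ _ 16 _ _ _ _ xs) => // n; rewrite ?sqr_ge0 //.
  have := Vx n; have := mxnorm1_ge0 (V n); nra.
Qed.

Hypothesis KH : Ht t K.
Hypothesis K_sa : hstar t K = K.
Hypothesis K_sqr : K ^+ 2 = Lambda_op t alpha.

(** [P] is a right inverse of [K ^+ 2], which equals [Lambda_op t alpha]. *)
Let KKP : K * (K * P) = 1.
Proof.
rewrite mulrA -expr2 K_sqr /Lambda_op (hstarE t0 alphaH).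
exact: stein_mulLP GU GammaE.
Qed.

Let Ht_b : Ht t b.
Proof.
apply: HtM => //; last by apply: HtV => //; exact: Ht_Gamma.
by apply: HtM => //; [exact: Ht_Gamma|exact: Ht_mxstar].
Qed.

Let Ht_P : Ht t P.
Proof.
apply: HtD => //; first by apply: HtV => //; exact: Ht_Gamma.
by apply: HtM => //; exact: Ht_mxstar.
Qed.

Lemma Blaschke_division f : hardy2 t f -> hseries_eval f alpha = 0 ->
  exists g : hseries R, [/\ hardy2 t g, f = star_mul (Blaschke t alpha K) g &
    hform t f f = hform t g g].
Proof.
move=> fH2 /(linear_factor_of_eval0 fH2)[V [V0 fV VH Vs]].
have [fH _] := fH2.
(* Solves [K * g n = u n - b * u (n - 1)] with [u n = V n.+1], the inverse of [K] being [K * P]. *)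
pose g : hseries R := fun n => K * P * (V n.+1 - b * V n).
have gH n : Ht t (g n).
  by rewrite /g; apply: HtM; [|exact: HtM|apply: HtB => //; exact: HtM].
have Kg n : K * g n = V n.+1 - b * V n by rewrite /g mulrA KKP mul1r.
(* Both sequences obey the same first-order recursion, and [V 0 = 0] makes them agree at the
   start. *)
have gV n : resolvent_sum g n = V n.+1.
  elim: n => [|n IH].
    rewrite /resolvent_sum big_ord_recl big_ord0 addr0 subnn expr0 mul1r Kg.
    by rewrite V0 mulr0 subr0.
  by rewrite resolvent_sumS IH Kg addrC subrK.
have gH2 : hardy2 t g.
  apply/(hardy2P t0); split=> //.
  pose M := mxnorm1 (K * P) * (1 + mxnorm1 b).
  have M0 : 0 <= M by rewrite mulr_ge0 ?addr_ge0 ?mxnorm1_ge0.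
  have gn n : mxnorm1 (g n) <= M * (mxnorm1 (V n.+1) + mxnorm1 (V n)).
    rewrite /M -mulrA (le_trans (ler_mxnorm1M _ _)) // ler_wpM2l ?mxnorm1_ge0 //.
    have := ler_mxnorm1B (V n.+1) (b * V n).
    have := ler_mxnorm1M b (V n).
    have := mulr_ge0 (mxnorm1_ge0 b) (mxnorm1_ge0 (V n.+1)).
    have := mxnorm1_ge0 (V n); lra.
  have Vs1 : cvgn (series (fun n => mxnorm1 (V n.+1) ^+ 2)).
    exact: (is_cvg_series_shiftS Vs).
  have Vs2 : cvgn (series
      (fun n => mxnorm1 (V n.+1) ^+ 2 + mxnorm1 (V n) ^+ 2)).
    have -> : series (fun n => mxnorm1 (V n.+1) ^+ 2 + mxnorm1 (V n) ^+ 2) =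
        series (fun n => mxnorm1 (V n.+1) ^+ 2) \+
        series (fun n => mxnorm1 (V n) ^+ 2).
      by apply/funext => n; rewrite /= !seriesEnat /= big_split.
    exact: is_cvgD.
  have MM : 0 <= 2 * M ^+ 2 by rewrite mulr_ge0 ?sqr_ge0.
  apply: (le_series_cvgZ MM _ _ _ Vs2) => n; rewrite ?sqr_ge0 //.
    by rewrite addr_ge0 ?sqr_ge0.
  apply: (@le_trans _ _ ((M * (mxnorm1 (V n.+1) + mxnorm1 (V n))) ^+ 2)).
    by rewrite ler_sqr ?nnegrE ?mulr_ge0 ?addr_ge0 ?mxnorm1_ge0.
  move: M (mxnorm1 (V n.+1)) (mxnorm1 (V n)) {gn M0 MM} => M x y.
  rewrite -subr_ge0.
  have -> : 2 * M ^+ 2 * (x ^+ 2 + y ^+ 2) - (M * (x + y)) ^+ 2 =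
    (M * (x - y)) ^+ 2 by ring.
  exact: sqr_ge0.
exists g; split=> //.
  apply/funext => n; rewrite star_mul_Blaschke gV fV; congr (_ - _).
  by case: n => [|n] /=; rewrite ?V0 ?gV.
pose sq q := complex.Re (\tr (mxstar t q * q)).
(* The quantity whose increments are the differences between the summands of the two forms. *)
pose e n := complex.Re (\tr (mxstar t (V n) * G^-1 * V n)).
have Ge : mxstar t G^-1 = G^-1 by rewrite (mxstarV t0) // mxstar_Gamma.
have se : mxstar t alphas = alpha by exact: mxstarK.
have Pe : mxstar t P = P.
  by rewrite /P mxstarD Ge (mxstarM t0 alphas) se.
have be : mxstar t b = G^-1 * alpha * G.
  by rewrite /b (mxstarM t0 (G * alphas)) (mxstarM t0 G) Ge se mxstar_Gamma mulrA.
have Ke : mxstar t K = K by rewrite -(hstarE t0 KH).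
have sqg n : sq (g n) = sq (f n) + (e n.+1 - e n).
  apply/eqP; rewrite addrC -subr_eq /sq /e -!Re_mxtraceB; apply/eqP.
  congr (complex.Re (\tr _)).
  (* Used with [u = V n.+1] and [v = V n]. In the square of [g n] the middle factor
     [P * K * (K * P)] reduces to [P]. *)
  rewrite -(stein_telescope GU GammaE) -/b -/P fV; congr (_ - _).
    rewrite {1}/g (mxstarM t0 (K * P)) (mxstarM t0 K) Pe Ke mxstarB.
    rewrite (mxstarM t0 b) be /g -!mulrA; congr (_ * _).
    by rewrite [K * (P * _)]mulrA [K * (K * P * _)]mulrA KKP mul1r.
  by rewrite mxstarB (mxstarM t0 alpha).
have sform (h : hseries R) : hardy2 t h -> hform t h h = limn (series (sq \o h)).
  move=> [hH _]; rewrite /hform; congr (limn (series _)).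
  by apply/funext => n; rewrite /sq /= hstarE.
(* The increments of [e] telescope, and [e 0 = 0] because [V 0 = 0]. *)
have sge : series (sq \o g) = series (sq \o f) \+ e.
  apply/funext => n; elim: n => [|n IH].
    by rewrite /= !seriesEnat /= !big_geq // /e V0 mulr0 mxtrace0 addr0.
  by rewrite /= !seriesSr IH /= sqg; ring.
(* [e n] is bounded by a multiple of the squared norm of [V n], the general term of a convergent
   series. *)
have e0 : e n @[n --> \oo] --> (0 : R).
  have [C C0 HC] := mxnorm1_mxstar t.
  have eV n : `|e n| <= C * mxnorm1 G^-1 * mxnorm1 (V n) ^+ 2.
    rewrite /e (le_trans (ler_Re_mxtrace _)) // (le_trans (ler_mxnorm1M _ _)) //.
    rewrite expr2 mulrA ler_wpM2r ?mxnorm1_ge0 //.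
    rewrite (le_trans (ler_mxnorm1M _ _)) //.
    by rewrite mulrAC ler_wpM2r ?mxnorm1_ge0.
  pose v : R^nat := fun n => C * mxnorm1 G^-1 * mxnorm1 (V n) ^+ 2.
  have v0 : v @ \oo --> 0.
    rewrite -[X in _ --> X](mulr0 (C * mxnorm1 G^-1)).
    by apply: cvgM; [exact: cvg_cst|exact: (cvg_series_cvg_0 Vs)].
  have v0N : - v @ \oo --> 0 by rewrite -[X in _ --> X]oppr0; exact: cvgN.
  by apply: (squeeze_cvgr _ v0N v0); apply: nearW => n; rewrite -ler_norml eV.
have fcv := hform_cvg t0 fH2.
rewrite !sform // sge; apply/esym/cvg_lim; first exact: Rhausdorff.
rewrite -[X in _ --> X]addr0; apply: cvgD e0.
rewrite (_ : sq \o f = fun n => complex.Re (\tr (hstar t (f n) * f n))) //.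
by apply/funext => n; rewrite /sq /= hstarE.
Qed.

End BlaschkeFactor.

Theorem theorem5p6 (R : realType) (t : R) (alpha K : 'M[Cplx R]_2)
    (t_neq0 : t != 0)
    (alphaH : Ht t alpha)
    (alpha_lt1 : opnorm alpha < 1)
    (Gam_unit : Gamma_op t alpha \is a GRing.unit)
    (KH : Ht t K)
    (K_sa : hstar t K = K)
    (K_sqr : K ^+ 2 = Lambda_op t alpha)
    (f : hseries R) (fH2 : hardy2 t f) :
  hseries_eval f alpha = 0 <->
  exists g : hseries R,
    [/\ hardy2 t g, f = star_mul (Blaschke t alpha K) g & hform t f f = hform t g g].
Proof.
split=> [|[g [gH2 fE _]]]; first exact: Blaschke_division.
(* The product [f] equals [q - alpha] times the bounded sequence [resolvent_sum g], so its
   evaluation telescopes to 0. *)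
have [B uB] := resolvent_sum_bounded K t_neq0 alpha_lt1 Gam_unit gH2.
apply: (eval_linear_factor alpha_lt1 _ uB) => n.
by rewrite fE star_mul_Blaschke.
Qed.
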